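(* Let $k$ be an algebraically closed field of characteristic zero and let $X$ be a smooth affine surface over $k$ such that $\mathcal{O}(X)$ is a unique factorisation domain. Then $\mathcal{O}_{ch}(X)=k$ if and only if some chain connected component of $X$ is dense in $X$.
   Context: A line in $X$ is a non-constant $k$-morphism $g:\mathbb{A}^1_k\to X$. For such $g$, $\mathcal{O}_{ch,g}(X)=\{f\in\mathcal{O}(X): f\circ g \text{ is constant}\}$, and $\mathcal{O}_{ch}(X)=\bigcap_{g\in\operatorname{Hom}(\mathbb{A}^1_k,X)}\mathcal{O}_{ch,g}(X)$, the intersection over all $k$-morphisms $\mathbb{A}^1_k\to X$; it is a $k$-subalgebra of $\mathcal{O}(X)$ containing $k$. A chain connected component of $X$ is a maximal subset $T\subseteq X(k)$ such that any two points of $T$ can be joined by a finite chain of lines in $X$ (consecutive images intersecting). *)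

(* Defs.v *)
From HB Require Import structures.
From mathcomp Require Import all_boot all_order all_algebra.
From mathcomp Require Import mpoly.
Set Implicit Arguments. Unset Strict Implicit. Unset Printing Implicit Defensive.
Import Order.TTheory GRing.Theory Num.Theory.
Local Open Scope ring_scope.

Section AffineVariety.
Variables (k : fieldType) (n m : nat).
Variable s : 'I_m -> {mpoly k[n]}.

Definition point := 'I_n -> k.

Definition onX (x : point) : Prop := forall i, (s i).@[x] = 0.

(* The s_i generate the full ideal I(X) of polynomials vanishing on X(k);
   hence O(X) = k[x_1..x_n]/I(X) and polynomials represent regular functions. *)
Definition generates_ideal : Prop :=
  forall p : {mpoly k[n]}, (forall x, onX x -> p.@[x] = 0) ->
    exists c : 'I_m -> {mpoly k[n]}, p = \sum_(i < m) c i * s i.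

Definition eqX (p q : {mpoly k[n]}) : Prop := forall x, onX x -> p.@[x] = q.@[x].

Definition unitX (p : {mpoly k[n]}) : Prop := exists q, eqX (p * q) 1.

Definition irredX (p : {mpoly k[n]}) : Prop :=
  ~ eqX p 0 /\ ~ unitX p /\
  forall a b, eqX p (a * b) -> unitX a \/ unitX b.

Definition assocX (p q : {mpoly k[n]}) : Prop := exists u, unitX u /\ eqX p (u * q).

Definition irred_seq (l : seq {mpoly k[n]}) : Prop := forall q, q \in l -> irredX q.

Definition UFD_OX : Prop :=
  ~ eqX 1 0 /\
  (forall p q, eqX (p * q) 0 -> eqX p 0 \/ eqX q 0) /\
  (forall p, ~ eqX p 0 -> ~ unitX p ->
     exists l : seq {mpoly k[n]}, irred_seq l /\ eqX p (\prod_(q <- l) q)) /\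
  (forall l1 l2 : seq {mpoly k[n]},
     irred_seq l1 -> irred_seq l2 ->
     eqX (\prod_(q <- l1) q) (\prod_(q <- l2) q) ->
     size l1 = size l2 /\
     exists f : nat -> nat,
       (forall i, (i < size l1)%N -> (f i < size l1)%N) /\
       (forall i j, (i < size l1)%N -> (j < size l1)%N -> f i = f j -> i = j) /\
       (forall i, (i < size l1)%N -> assocX (nth 0 l1 i) (nth 0 l2 (f i)))).

Definition alg_indep (r : nat) (f : 'I_r -> {mpoly k[n]}) : Prop :=
  forall P : {mpoly k[r]},
    (forall x, onX x -> P.@[fun i => (f i).@[x]] = 0) -> P = 0.

(* dim X = 2, i.e. trdeg_k k(X) = 2. *)
Definition dim_two : Prop :=
  (exists f : 'I_2 -> {mpoly k[n]}, alg_indep f) /\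
  ~ (exists f : 'I_3 -> {mpoly k[n]}, alg_indep f).

(* Jacobian criterion: X smooth of dimension 2 at every point. *)
Definition jacobian_rank_ok : Prop :=
  forall x, onX x ->
    \rank (\matrix_(i < m, j < n) ((s i)^`M(j)).@[x]) = (n - 2)%N.

Definition smooth_affine_surface : Prop :=
  generates_ideal /\ dim_two /\ jacobian_rank_ok.

Definition morphA1 (g : 'I_n -> {poly k}) : Prop :=
  forall t : k, onX (fun j => (g j).[t]).

Definition line (g : 'I_n -> {poly k}) : Prop :=
  morphA1 g /\ exists j, (1 < size (g j))%N.

Definition on_image (g : 'I_n -> {poly k}) (x : point) : Prop :=
  exists t : k, forall j, x j = (g j).[t].

Definition in_Och (f : {mpoly k[n]}) : Prop :=
  forall g, morphA1 g -> forall t1 t2 : k,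
    f.@[fun j => (g j).[t1]] = f.@[fun j => (g j).[t2]].

Definition Och_trivial : Prop :=
  forall f, in_Och f -> exists c : k, eqX f c%:MP.

Definition chain_conn (x y : point) : Prop :=
  x = y \/
  exists (r : nat) (g : nat -> 'I_n -> {poly k}),
    (forall i, (i <= r)%N -> line (g i)) /\
    on_image (g 0%N) x /\ on_image (g r) y /\
    (forall i, (i < r)%N -> exists z, on_image (g i) z /\ on_image (g i.+1) z).

Definition chain_pairwise (T : point -> Prop) : Prop :=
  (forall x, T x -> onX x) /\ forall x y, T x -> T y -> chain_conn x y.

Definition chain_component (T : point -> Prop) : Prop :=
  chain_pairwise T /\
  forall T' : point -> Prop, (forall x, T x -> T' x) -> chain_pairwise T' ->
    forall x, T' x -> T x.

Definition denseX (T : point -> Prop) : Prop :=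
  forall p : {mpoly k[n]}, (forall x, T x -> p.@[x] = 0) ->
    forall x, onX x -> p.@[x] = 0.

End AffineVariety.

(* Main.v *)
Require Import Defs.
From HB Require Import structures.
From mathcomp Require Import all_boot all_order all_algebra.
From mathcomp Require Import mpoly zify.
From Stdlib Require Import Classical.
Set Implicit Arguments. Unset Strict Implicit. Unset Printing Implicit Defensive.
Import GRing.Theory.
Local Open Scope ring_scope.

(** A function in [O_ch] is constant on chain components, so a dense component
    forces [O_ch = k].  Conversely, X contains a line, since otherwise
    [O_ch = O(X)]; let [T] be its component and suppose that a nonzero [p] vanishes on [T].  Let [f] be the product of the
    prime factors [q] of [p] that vanish on a line inside [T].  Each such [q]
    cuts out an irreducible curve, which must be the image of the line, so the
    zeros of [f] lie in [T].  A line inside [T] makes [p], hence [f], vanish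
    identically; on any other line [f] has no zero, hence is constant.  Thus [f]
    is in [O_ch], so it is constant, so it is 0; then [T = X] and [p = 0]. *)

(** * Lowest terms in the last variable *)

Lemma mmap_mwiden n (R S : comNzRingType) (f : {rmorphism R -> S})
    (h : 'I_n.+1 -> S) (p : {mpoly R[n]}) :
  mmap f h (mwiden p) = mmap f (fun i : 'I_n => h (widen_ord (leqnSn n) i)) p.
Proof.
elim/mpolyind: p => [|c m p _ _ IH]; first by rewrite mwiden0 !raddf0.
rewrite mwidenD !raddfD /= IH mwidenZ mwidenX !mmapZ !mmapX.
congr (_ * _ + _); rewrite /mmap1 big_ord_recr /= mnmwiden_ordmax expr0 mulr1.
by apply: eq_bigr => i _; rewrite mnmwiden_widen.
Qed.

Lemma mpoly_split_last n (R : comNzRingType) (p : {mpoly R[n.+1]}) :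
  exists p0 p1, p = mwiden p0 + 'X_ord_max * p1.
Proof.
elim/mpolyind: p => [|c m p _ _ [p0 [p1 ->]]].
  by exists 0, 0; rewrite mwiden0 mulr0 addr0.
have [m0|m_gt0] := posnP (m ord_max).
- exists (c *: 'X_[[multinom m (widen_ord (leqnSn n) i) | i < n]] + p0), p1.
  rewrite mwidenD mwidenZ mwidenX addrA; congr (_ *: 'X_[_] + _ + _).
  apply/mnmP => i; case: (unliftP ord_max i) => [j ->|->]; last first.
    by rewrite mnmwiden_ordmax.
  have -> : lift ord_max j = widen_ord (leqnSn n) j.
    by apply: val_inj; rewrite [LHS]lift_max.
  by rewrite mnmwiden_widen mnmE.
- exists p0, (c *: 'X_[m - U_(ord_max)] + p1).
  rewrite mulrDr addrCA; congr (_ + (_ + _)).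
  rewrite -scalerAr -mpolyXD addmC submK //.
  by apply/mnm_lepP => i; rewrite mnm1E; case: eqP => // <-.
Qed.

(** Divide out the last variable as long as it divides [p], by induction on the size; once it no
    longer does, the part [p0] free of it is nonzero. *)
Lemma mpoly_lowest_term n (R : idomainType) (p : {mpoly R[n.+1]}) :
  p != 0 -> exists e p0 p1,
    p0 != 0 /\ p = 'X_ord_max ^+ e * (mwiden p0 + 'X_ord_max * p1).
Proof.
have [d] := ubnP (msize p); elim: d p => // d IH p; rewrite ltnS => le_p_d nz_p.
have [p0 [p1 Dp]] := mpoly_split_last p.
have [p0_0|nz_p0] := eqVneq p0 0; last first.
  by exists 0, p0, p1; rewrite expr0 mul1r.
rewrite p0_0 mwiden0 add0r in Dp.
have nz_p1 : p1 != 0 by apply: contraNneq nz_p => p1_0; rewrite Dp p1_0 mulr0.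
have lt_p1_d : (msize p1 < d)%N.
  apply: leq_trans le_p_d; rewrite Dp msizeM // ?msizeX ?mdeg1 //.
  by rewrite -msize_poly_eq0 msizeX.
have [e [q0 [q1 [nz_q0 Dp1]]]] := IH _ lt_p1_d nz_p1.
by exists e.+1, q0, q1; rewrite exprS -mulrA -Dp1.
Qed.

(** * Equations for the image of a line *)

Lemma mpoly_Bezout (k : fieldType) n (p : 'I_n -> {poly k}) :
  exists h : 'I_n -> {poly k}, forall i, \sum_j h j * p j %| p i.
Proof.
elim: n p => [|n IH] p; first by exists p; case.
have [h dvd_h] := IH (fun i => p (lift ord0 i)).
have [[u v] /= Duv] := Bezoutp (p ord0) (\sum_j h j * p (lift ord0 j)).
(* The combination becomes a gcd of [p ord0] and the combination of the other entries. *)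
exists (fun i => if unlift ord0 i is Some j then v * h j else u) => i.
rewrite big_ord_recl unlift_none.
rewrite (eq_bigr (fun j => v * (h j * p (lift ord0 j)))) => [|j _]; last first.
  by rewrite liftK mulrA.
rewrite -mulr_sumr (eqp_dvdl _ Duv).
case: (unliftP ord0 i) => [j ->|->]; last exact: dvdp_gcdl.
exact: dvdp_trans (dvdp_gcdr _ _) (dvd_h j).
Qed.

Definition pullback (k : fieldType) n (g : 'I_n -> {poly k}) (p : {mpoly k[n]}) :=
  mmap polyC g p.

Lemma horner_pullback (k : fieldType) n (g : 'I_n -> {poly k}) p t :
  (pullback g p).[t] = p.@[fun j => (g j).[t]].
Proof.
rewrite /pullback; elim/mpolyind: p => [|c m p _ _ IH].
  by rewrite raddf0 horner0 meval0.
rewrite raddfD mevalD hornerD IH; congr (_ + _).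
rewrite /= mmapZ mmapX mevalZ mevalX hornerM hornerC; congr (_ * _).
by rewrite horner_prod; apply: eq_bigr => i _; rewrite horner_exp.
Qed.

Lemma closed_poly_eq0 (k : closedFieldType) (p : {poly k}) :
  (forall t, p.[t] = 0) -> p = 0.
Proof.
move=> p0; apply/eqP; apply: contraT => /closed_nonrootP[t].
by rewrite rootE p0 eqxx.
Qed.

(* The equation of the image that is nonzero at [x] is the resultant in [t] of
   [g_j(t) - X_j] and a Bezout combination of the [g_i(t) - X_i] equal to a
   nonzero constant when [X = x]. *)
Lemma line_image_closed (k : closedFieldType) n (g : 'I_n -> {poly k}) j x :
  (1 < size (g j))%N -> ~ on_image g x ->
  exists a : {mpoly k[n]}, pullback g a = 0 /\ a.@[x] != 0.
Proof.
move=> gj_nc x_out.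
have [h dvd_h] := mpoly_Bezout (fun i => g i - (x i)%:P).
set d := \sum_i _ in dvd_h.
(* A root [t] of [d] would be a common root of all [g i - x i], putting [x] on the image. *)
have d_const : size d = 1.
  apply/eqP; apply: contraT => /closed_rootP[t dt0]; case: x_out; exists t => i.
  have /dvdpP[q /(congr1 (fun p => p.[t]))] := dvd_h i.
  rewrite hornerD hornerN hornerC hornerM (rootP dt0) mulr0.
  by move/eqP; rewrite subr_eq0 => /eqP.
(* [map_resultant] only handles morphisms whose source is a polynomial ring,
   hence the extra layer of polynomials, evaluated at 0. *)
pose c (b : k) : {poly {mpoly k[n]}} := (b%:MP)%:P.
pose D i : {poly {poly {mpoly k[n]}}} := map_poly c (g i) - (('X_i)%:P)%:P.
(* [S] is [d] with the coordinates of [x] replaced by variables. *)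
pose S := \sum_i map_poly c (h i) * D i.
pose A := D j.
(* The summand [A * 'X^N] only fixes the leading coefficient, so that
   specialization commutes with the resultant. *)
pose B := A * 'X^(size S) + S.
have [ev evE] : exists ev : ('I_n -> k) -> {rmorphism {poly {mpoly k[n]}} -> k},
    forall v p, ev v p = p.[0].@[v].
  by exists (fun v => meval v \o horner_eval 0).
have ev_c v b : ev v (c b) = b by rewrite evE hornerC mevalC.
have ev_map v p : map_poly (ev v) (map_poly c p) = p.
  by rewrite -map_poly_comp map_poly_id // => b _; apply: ev_c.
have ev_D v i : map_poly (ev v) (D i) = g i - (v i)%:P.
  by rewrite rmorphB /= ev_map map_polyC /= evE hornerC mevalXU.
have ev_S v : map_poly (ev v) S = \sum_i h i * (g i - (v i)%:P).
  by rewrite rmorph_sum; apply: eq_bigr => i _; rewrite rmorphM /= ev_map ev_D.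
have ev_B v : map_poly (ev v) B =
    (g j - (v j)%:P) * 'X^(size S) + \sum_i h i * (g i - (v i)%:P).
  by rewrite rmorphD /= ev_S rmorphM /= ev_D map_polyXn.
have c_inj : injective c by move=> b b' /(congr1 (ev x)); rewrite !ev_c.
have c0 : c 0 = 0 by rewrite /c mpolyC0 polyC0.
have szG : size (map_poly c (g j)) = size (g j) by rewrite size_map_inj_poly.
have lcA : lead_coef A = c (lead_coef (g j)).
  rewrite lead_coefDl ?size_polyN ?szG; first by rewrite lead_coef_map_inj.
  exact: leq_ltn_trans (size_polyC_leq1 _) gj_nc.
have szA : (1 < size A)%N.
  by rewrite size_polyDl ?szG ?size_polyN // (leq_ltn_trans (size_polyC_leq1 _)).
have lcB : lead_coef B = lead_coef A.
  rewrite lead_coefDl; first exact: lead_coef_Mmonic (monicXn _ _).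
  rewrite size_mulXn -?size_poly_gt0 ?(ltnW szA) //.
  by rewrite -[X in (X < _)%N]addn0 ltn_add2l (ltnW szA).
have nz_lc : lead_coef (g j) != 0 by rewrite lead_coef_eq0 -size_poly_gt0 ltnW.
have ev_res v : (resultant A B).[0].@[v] =
    resultant (map_poly (ev v) A) (map_poly (ev v) B).
  by rewrite -evE map_resultant ?lcB ?lcA ?ev_c.
exists (resultant A B).[0]; split.
(* At the point with parameter [t], every [D i] vanishes at [t], so [A] and [B] share this root. *)
- apply: closed_poly_eq0 => t; rewrite horner_pullback ev_res.
  apply/eqP; rewrite resultant_eq0 ev_B ev_D.
  set p := gcdp _ _.
  have pt0 : root p t.
    have Dt0 i : (g i - ((g i).[t])%:P).[t] = 0.
      by rewrite hornerD hornerN hornerC subrr.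
    rewrite root_gcd !rootE Dt0 eqxx /= hornerD hornerM Dt0.
    rewrite mul0r add0r horner_sum big1 ?eqxx // => i _.
    by rewrite hornerM Dt0 mulr0.
  rewrite ltnNge; apply/negP => /size1_polyC Dp.
  have nz_p : p != 0.
    rewrite gcdp_eq0 negb_and -[X in ~~ X || _]size_poly_eq0.
    rewrite size_polyDl ?size_polyN ?(leq_ltn_trans (size_polyC_leq1 _)) //.
    by rewrite -lt0n (ltnW gj_nc).
  by move: pt0 nz_p; rewrite Dp rootC => /eqP->; rewrite polyC0 eqxx.
(* Modulo [A], [B] is [S], which at [x] becomes the nonzero constant [d]; hence the two are
   coprime. *)
- rewrite ev_res resultant_eq0 -leqNgt ev_B ev_D -/d leq_eqVlt; apply/orP; left.
  rewrite -/(coprimep _ _) mulrC coprimep_addl_mul.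
  by rewrite (eqp_coprimepr _ (_ : d %= 1)) ?coprimep1 // -size_poly_eq1 d_const.
Qed.

(** * Substitution into polynomials *)

Lemma mmap_lowest_term n (R : idomainType) (p : {mpoly R[n.+1]}) :
  p != 0 -> exists e p0 p1, p0 != 0 /\
    forall (S : comNzRingType) (f : {rmorphism R -> S}) (h : 'I_n.+1 -> S),
      mmap f h p = h ord_max ^+ e *
        (mmap f (fun i => h (widen_ord (leqnSn n) i)) p0 +
         h ord_max * mmap f h p1).
Proof.
case/mpoly_lowest_term=> e [p0 [p1 [nz_p0 ->]]]; exists e, p0, p1; split=> // S f h.
by rewrite rmorphM rmorphXn rmorphD rmorphM /= mmap_mwiden mmapX mmap1U.
Qed.

Lemma meval_mmapC n r (R : comNzRingType) (h : 'I_r -> {mpoly R[n]}) p x :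
  (mmap (@mpolyC n R) h p).@[x] = p.@[fun i => (h i).@[x]].
Proof.
rewrite [in RHS]/meval /mmap rmorph_sum; apply: eq_bigr => m _ /=.
rewrite mevalM mevalC rmorph_prod; congr (_ * _).
by apply: eq_bigr => i _; rewrite rmorphXn.
Qed.

(** * Divisibility and algebraic relations in the coordinate ring *)

Section CoordinateRing.
Variables (k : fieldType) (n m : nat) (s : 'I_m -> {mpoly k[n]}).
Implicit Types (a b p q : {mpoly k[n]}) (l : seq {mpoly k[n]}).

Definition dvdX q p := exists c, eqX s p (q * c).

Lemma dvdX_mem_prod q r p l :
  assocX s q r -> r \in l -> eqX s p (\prod_(i <- l) i) -> dvdX q p.
Proof.
move=> [u [[u' u_u'] Dq]] l_r Dp; exists (u' * \prod_(i <- rem r l) i) => x Xx.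
rewrite Dp // (big_rem _ l_r) /= !mevalM Dq // mevalM.
have := u_u' x Xx; rewrite mevalM meval1 => uu'.
by rewrite mulrA [_ * u'.@[x]]mulrAC uu' mul1r.
Qed.

(** Factor [a], [b] and [c] into irreducibles: uniqueness matches [q] with a factor of [a] or of
    [b]. [UFD_OX] factors only nonzero nonunits, so zeros and units are treated first. *)
Lemma irredX_prime q a b :
  UFD_OX s -> irredX s q -> dvdX q (a * b) -> dvdX q a \/ dvdX q b.
Proof.
move=> [_ [dom [fact uniq]]] irr_q [c Dab].
have [nz_q [_ split_q]] := irr_q.
have dvd0 p : eqX s p 0 -> dvdX q p.
  by move=> p0; exists 0 => x Xx; rewrite mulr0 p0.
have dvd_unit a' b' : unitX s a' -> eqX s (a' * b') (q * c) -> dvdX q b'.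
  move=> [v av] Da'b'; exists (c * v) => x Xx.
  have := av x Xx; have := Da'b' x Xx; rewrite !mevalM meval1 mulrA => <- av1.
  by rewrite mulrAC av1 mul1r.
case: (classic (eqX s a 0)) => [/dvd0|nz_a]; first by left.
case: (classic (eqX s b 0)) => [/dvd0|nz_b]; first by right.
case: (classic (unitX s a)) => [ua|nu_a]; first by right; apply: dvd_unit ua Dab.
case: (classic (unitX s b)) => [ub|nu_b].
  by left; apply: dvd_unit ub _; rewrite mulrC.
case: (classic (eqX s c 0)) => [c0|nz_c].
  by case: (dom a b) => // x Xx; rewrite Dab // mevalM c0 // meval0 mulr0.
(* For a unit [c], [q] equals [a * (b * v)], a product of two nonunits, contrary to
   irreducibility. *)
case: (classic (unitX s c)) => [[v cv]|nu_c].
  case: (split_q a (b * v)) => [x Xx|//|[w bvw]].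
    rewrite mulrA mevalM Dab // mevalM.
    by have := cv x Xx; rewrite mevalM meval1 -mulrA => ->; rewrite mulr1.
  by case: nu_b; exists (v * w); rewrite mulrA.
have [la [irr_la Da]] := fact a nz_a nu_a.
have [lb [irr_lb Db]] := fact b nz_b nu_b.
have [lc [irr_lc Dc]] := fact c nz_c nu_c.
have irr_l1 : irred_seq s (q :: lc).
  by move=> r; rewrite inE => /orP[/eqP->|/irr_lc].
have irr_l2 : irred_seq s (la ++ lb).
  by move=> r; rewrite mem_cat => /orP[/irr_la|/irr_lb].
have [x Xx|sz [f [ltf [_ assoc_f]]]] := uniq _ _ irr_l1 irr_l2.
  by rewrite big_cons big_cat /= !mevalM -Da // -Db // -Dc // -!mevalM -Dab.
(* Index 0 of the first list is [q]; its partner [r] lies in [la] or in [lb]. *)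
have := assoc_f 0 isT; have := ltf 0 isT; rewrite sz => /(mem_nth 0).
move: (nth _ _ _) => r; rewrite mem_cat => /orP[] l_r q_r.
  by left; apply: dvdX_mem_prod q_r l_r Da.
by right; apply: dvdX_mem_prod q_r l_r Db.
Qed.

Lemma dim_two_relation (f : 'I_3 -> {mpoly k[n]}) :
  dim_two s -> exists2 P, P != 0 & eqX s (mmap (@mpolyC n k) f P) 0.
Proof.
case=> _ no_indep; apply: NNPP => no_P; apply: no_indep; exists f => P P0.
apply/eqP; apply: contraT => nz_P; case: no_P; exists P => // x Xx.
by rewrite meval_mmapC P0 // meval0.
Qed.

Lemma domX_exp a b e :
  UFD_OX s -> ~ eqX s a 0 -> eqX s (a ^+ e * b) 0 -> eqX s b 0.
Proof.
move=> [_ [dom _]] nz_a; elim: e => [|e IH]; first by rewrite expr0 mul1r.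
by rewrite exprS -mulrA => /dom[].
Qed.

Lemma primeX_exp q a b e :
  UFD_OX s -> irredX s q -> ~ dvdX q a -> dvdX q (a ^+ e * b) -> dvdX q b.
Proof.
move=> ufd irr_q na; elim: e => [|e IH]; first by rewrite expr0 mul1r.
by rewrite exprS -mulrA => /(irredX_prime ufd irr_q)[].
Qed.

End CoordinateRing.

(** * Irreducible curves containing a line *)

Section Curve.
Variables (k : closedFieldType) (n m : nat) (s : 'I_m -> {mpoly k[n]}).

(* As [dim X = 2], some [a] vanishing on the line but not at [x], a coordinate [y]
   that is nonconstant on the line, and [q] are algebraically dependent.
   Cancelling powers of [q], then of [a] modulo the prime [q], leaves a relation
   whose restriction to the line is a nontrivial algebraic equation for [y]. *)
Lemma irredX_zeros_on_line q (g : 'I_n -> {poly k}) x :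
  dim_two s -> UFD_OX s -> irredX s q -> line s g -> pullback g q = 0 ->
  onX s x -> q.@[x] = 0 -> on_image g x.
Proof.
move=> dim2 ufd irr_q [Xg [j gj_nc]] gq0 Xx qx0; apply: NNPP => x_out.
have [a [ga0 nz_ax]] := line_image_closed gj_nc x_out.
have q_ndvd_a : ~ dvdX s q a.
  by case=> c Da; case/eqP: nz_ax; rewrite Da // mevalM qx0 mul0r.
have nz_q : ~ eqX s q 0 by case: irr_q.
(* Subtracting the value at parameter 0 makes [y] vanish there, so evaluating the final relation at
   0 isolates its constant term [H]. *)
pose y : {mpoly k[n]} := 'X_j - ((g j).[0])%:MP.
(* The order matters: the last variable is stripped first, so [q] goes before [a], and [a] before
   [y]. *)
pose f r (i : 'I_r) : {mpoly k[n]} := nth 0 [:: y; a; q] i.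
have [P nz_P P0] := dim_two_relation (f 3) dim2.
have [e2 [P0' [P1 [nz_P0 DP]]]] := mmap_lowest_term nz_P.
have {P0 DP} q_dvd : dvdX s q (mmap (@mpolyC n k) (f 2) P0').
  exists (- mmap (@mpolyC n k) (f 3) P1) => z Xz.
  have := domX_exp ufd nz_q _; move/(_ _ e2); rewrite DP in P0.
  move/(_ _ P0)/(_ z Xz); rewrite mevalD meval0 mulrN mevalN => /eqP.
  by rewrite addr_eq0 => /eqP.
have [e1 [Q0 [Q1 [nz_Q0 DQ]]]] := mmap_lowest_term nz_P0.
rewrite {}DQ in q_dvd; have [c Dc] := primeX_exp ufd irr_q q_ndvd_a q_dvd.
have [e0 [H [H1 [nz_H DH]]]] := mmap_lowest_term nz_Q0.
(* The relation becomes [y^e0 (H + y H1) = 0] along the line, [H] a constant. *)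
have yt t : y.@[fun i => (g i).[t]] = (g j - ((g j).[0])%:P).[t].
  by rewrite mevalB mevalXU mevalC hornerD hornerN hornerC.
pose w : {poly k} := g j - ((g j).[0])%:P.
have nz_w : w != 0.
  rewrite -size_poly_eq0 size_polyDl ?size_polyN ?(leq_ltn_trans (size_polyC_leq1 _)) //.
  by rewrite -lt0n ltnW.
have /eqP : w ^+ e0 * ((H@_0%MM)%:P + w * pullback g (mmap (@mpolyC n k) (f 1) H1)) = 0.
  apply: closed_poly_eq0 => t.
  have := Dc _ (Xg t); rewrite mevalD !mevalM -!horner_pullback ga0 gq0 !horner0.
  rewrite !mul0r addr0 DH {1}[H]nvar0_mpolyC mmapC horner_pullback.
  rewrite mevalM rmorphXn mevalD mevalM mevalC /= yt => <-.
  by rewrite hornerM horner_exp [X in _ * X]hornerD hornerM horner_pullback hornerC.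
rewrite mulf_eq0 expf_eq0 (negPf nz_w) andbF /= => /eqP/(congr1 (fun p => p.[0])).
rewrite hornerD hornerM hornerC hornerD hornerN hornerC subrr mul0r addr0 horner0.
by move=> H0; case/eqP: nz_H; rewrite [H]nvar0_mpolyC H0 mpolyC0.
Qed.
End Curve.

(** * Chains of lines and their components *)

Section Chains.
Variables (k : fieldType) (n m : nat) (s : 'I_m -> {mpoly k[n]}).
Implicit Types (x y z : point k n) (f : {mpoly k[n]}) (g : 'I_n -> {poly k}).

Lemma chain_conn_sym x y : chain_conn s x y -> chain_conn s y x.
Proof.
case=> [->|[r [g [line_g [gx [gy meet_g]]]]]]; first by left.
right; exists r, (fun i => g (r - i)%N); rewrite subn0 subnn; split.
  by move=> i _; apply: line_g; apply: leq_subr.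
do 2!split=> //; move=> i lt_i_r.
have [|z [gz g'z]] := meet_g (r - i.+1)%N; first by lia.
by exists z; split=> //; have <- : (r - i.+1).+1 = (r - i)%N by lia.
Qed.

Lemma chain_conn_trans x y z :
  chain_conn s x y -> chain_conn s y z -> chain_conn s x z.
Proof.
move=> [->//|[r [g [line_g [gx [gy meet_g]]]]]].
case=> [<-|[r' [g' [line_g' [g'y [g'z meet_g']]]]]]; first by right; exists r, g.
(* The two chains have [r + 1] and [r' + 1] lines, so the last index is [(r + r').+1]; they meet at
   [y], between indices [r] and [r.+1]. *)
right; exists (r + r').+1, (fun i => if (i <= r)%N then g i else g' (i - r.+1)%N).
split=> [i le_i|]; first by case: leqP => // lt_r_i; [exact: line_g | apply: line_g'; lia].
split=> //; split=> [|i lt_i].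
  by rewrite ltnNge leq_addr /= subSS addKn.
case: (ltngtP i r) => [lt_i_r|lt_r_i|->].
- exact: meet_g.
- have -> : (i.+1 - r.+1 = (i - r.+1).+1)%N by lia.
  by apply: meet_g'; lia.
- by exists y; rewrite subnn.
Qed.

Lemma line_chain_conn g x y :
  line s g -> on_image g x -> on_image g y -> chain_conn s x y.
Proof. by move=> line_g gx gy; right; exists 0, (fun=> g). Qed.

Definition chain_class x y := onX s y /\ chain_conn s x y.

Lemma chain_class_component x : onX s x -> chain_component s (chain_class x).
Proof.
move=> Xx; split; first split.
- by move=> y [].
- by move=> y z [_ xy] [_ xz]; apply: chain_conn_trans (chain_conn_sym xy) xz.
- move=> T' sub_T' [XT' connT'] y T'y; split; first exact: XT'.
  by apply: connT' => //; apply: sub_T'; split=> //; left.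
Qed.

Lemma onX_line g x : morphA1 s g -> on_image g x -> onX s x.
Proof.
by move=> Xg [t Dx] i; rewrite (meval_eq _ Dx); apply: Xg.
Qed.

Lemma chain_class_line x g y z :
  line s g -> on_image g y -> chain_class x y -> on_image g z -> chain_class x z.
Proof.
move=> line_g gy [_ xy] gz; split; first by apply: onX_line gz; case: line_g.
exact: chain_conn_trans xy (line_chain_conn line_g gy gz).
Qed.

Lemma in_Och_chain_conn f x y :
  in_Och s f -> chain_conn s x y -> f.@[x] = f.@[y].
Proof.
move=> Och_f; have const_f g y1 y2 : line s g -> on_image g y1 -> on_image g y2 ->
    f.@[y1] = f.@[y2].
  case=> Xg _ [t1 Dy1] [t2 Dy2].
  by rewrite (meval_eq _ Dy1) (meval_eq _ Dy2); apply: Och_f.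
case=> [->//|[r [g [line_g [gx [gy meet_g]]]]]].
elim: r y line_g gy meet_g => [|r IH] y line_g gy meet_g.
  exact: const_f (line_g 0 isT) gx gy.
have [z [gz g'z]] := meet_g r (leqnn _).
rewrite (IH z) //; first exact: const_f (line_g r.+1 _) g'z gy.
- by move=> i le_i; apply: line_g; apply: leqW.
- by move=> i lt_i; apply: meet_g; apply: leqW.
Qed.

Lemma dense_component_Och_trivial T :
  ~ eqX s 1 0 -> chain_component s T -> denseX s T -> Och_trivial s.
Proof.
move=> ne10 [[_ connT] _] denseT f Och_f.
(* If [T] were empty, density would make 1 vanish on X. *)
case: (classic (exists x, T x)) => [[x Tx]|noT]; last first.
  by case: ne10 => y Xy; rewrite meval0; apply: denseT Xy => x Tx; case: noT; exists x.
exists f.@[x] => y Xy; apply/eqP; rewrite -subr_eq0 -mevalB; apply/eqP.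
apply: denseT Xy => z Tz; rewrite mevalB mevalC.
by rewrite (in_Och_chain_conn Och_f (connT _ _ Tx Tz)) subrr.
Qed.

End Chains.

(** * From trivial [O_ch] to a dense component *)

Section Surface.
Variables (k : closedFieldType) (n m : nat) (s : 'I_m -> {mpoly k[n]}).
Implicit Types (f p q : {mpoly k[n]}) (g : 'I_n -> {poly k}).

Lemma pullback_eq0 g p :
  pullback g p = 0 <-> forall t, p.@[fun j => (g j).[t]] = 0.
Proof.
split=> [gp0 t|p0]; first by rewrite -horner_pullback gp0 horner0.
by apply: closed_poly_eq0 => t; rewrite horner_pullback.
Qed.

Lemma morphA1_const_or_line g :
  morphA1 s g -> line s g \/ forall t1 t2 j, (g j).[t1] = (g j).[t2].
Proof.
move=> Xg; case: (classic (exists j, (1 < size (g j))%N)) => [|no_j]; first by left.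
right=> t1 t2 j; have /size1_polyC -> : (size (g j) <= 1)%N.
  by rewrite leqNgt; apply/negP => gt1; apply: no_j; exists j.
by rewrite !hornerC.
Qed.

Lemma Och_trivial_line : dim_two s -> Och_trivial s -> exists g, line s g.
Proof.
move=> [[f indep_f] _] Och_k; apply: NNPP => no_line.
have [g Xg t1 t2|c fc] := Och_k (f ord0).
  case: (morphA1_const_or_line Xg) => [line_g|const_g]; first by case: no_line; exists g.
  exact: meval_eq (const_g t1 t2).
(* A constant [f ord0] satisfies the relation [X_0 - c], which is nonzero since its value at [c + 1]
   is 1. *)
have /(congr1 (meval (fun=> c + 1))) : 'X_ord0 - c%:MP_[2] = 0.
  by apply: indep_f => x Xx; rewrite mevalB mevalXU mevalC fc // mevalC subrr.
by rewrite mevalB mevalXU mevalC meval0 addrC addKr => /eqP; rewrite oner_eq0.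
Qed.

(** [f] keeps the factors that vanish on some line inside the class of [x]. As [k[t]] is a domain, a
    line of the class on which the product vanishes kills one factor, which was therefore kept. *)
Lemma zero_locus_of_lines x l :
  dim_two s -> UFD_OX s -> irred_seq s l ->
  exists f, (forall y, onX s y -> f.@[y] = 0 -> chain_class s x y) /\
    forall g, line s g -> (forall t, chain_class s x (fun j => (g j).[t])) ->
      pullback g (\prod_(q <- l) q) = 0 -> pullback g f = 0.
Proof.
move=> dim2 ufd; elim: l => [|q l IH] irr_l.
  exists 1; split=> [y _ /eqP|g _ _]; first by rewrite meval1 oner_eq0.
  by rewrite big_nil.
have [r l_r|f [f_zeros f_lines]] := IH; first by apply: irr_l; rewrite inE l_r orbT.
have pullM g p p' : pullback g (p * p') = pullback g p * pullback g p'.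
  exact: rmorphM.
pose q_line g := [/\ line s g, forall t, chain_class s x (fun j => (g j).[t])
                    & pullback g q = 0].
case: (classic (exists g, q_line g)) => [[g [line_g Tg gq0]]|no_g].
  exists (q * f); split=> [y Xy /eqP|g' line_g' Tg' /eqP].
    rewrite mevalM mulf_eq0 => /orP[]/eqP fy0; last exact: f_zeros.
    have irr_q : irredX s q by apply: irr_l; rewrite mem_head.
    apply: (chain_class_line line_g _ (Tg 0)); first by exists 0.
    exact: irredX_zeros_on_line irr_q line_g gq0 Xy fy0.
  rewrite big_cons !pullM mulf_eq0 => /orP[]/eqP z; first by rewrite z mul0r.
  by rewrite f_lines // mulr0.
exists f; split=> // g line_g Tg /eqP; rewrite big_cons pullM mulf_eq0.
by case/orP=> /eqP z; [case: no_g; exists g | apply: f_lines].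
Qed.

Lemma Och_trivial_dense_class g t :
  dim_two s -> UFD_OX s -> Och_trivial s -> line s g ->
  denseX s (chain_class s (fun j => (g j).[t])).
Proof.
set x := fun j => _ => dim2 ufd Och_k line_g p p_T; apply: NNPP => nz_p.
have Xx : onX s x by case: line_g => /(_ t).
have nz_pX : ~ eqX s p 0.
  by move=> p0; apply: nz_p => y Xy; rewrite p0 // meval0.
have nu_p : ~ unitX s p.
  case=> q pq; have := pq x Xx; rewrite mevalM meval1 p_T ?mul0r //.
    by move/esym/eqP; rewrite oner_eq0.
  by split=> //; left.
have [l [irr_l Dp]] := ufd.2.2.1 p nz_pX nu_p.
have [f [f_zeros f_lines]] := zero_locus_of_lines x dim2 ufd irr_l.
have line_f g' t' : line s g' -> chain_class s x (fun j => (g' j).[t']) ->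
    pullback g' f = 0.
  move=> line_g' Tt'; have Tg' t2 : chain_class s x (fun j => (g' j).[t2]).
    by apply: (chain_class_line line_g' _ Tt'); [exists t' | exists t2].
  apply: f_lines => //; apply/pullback_eq0 => t2.
  by rewrite -Dp; [apply: p_T | case: (Tg' t2)].
have [g' Xg' t1 t2|c fc] := Och_k f.
  case: (morphA1_const_or_line Xg') => [line_g'|const_g']; last exact: meval_eq (const_g' t1 t2).
  rewrite -!horner_pullback.
  (* A pullback that is not a nonzero constant has a root; there the line enters the class, so the
     pullback is 0. *)
  have [/eqP/size_poly1P[b _ ->]|] := eqVneq (size (pullback g' f)) 1.
    by rewrite !hornerC.
  case/closed_rootP=> t' /rootP gf0; rewrite (line_f g' t') ?horner0 //.
  by apply: f_zeros; rewrite -?horner_pullback.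
have fx0 : f.@[x] = 0.
  by rewrite -horner_pullback (line_f g t) ?horner0 //; split=> //; left.
apply: nz_p => y Xy; apply: p_T; apply: f_zeros => //.
by rewrite fc // mevalC; have := fc x Xx; rewrite mevalC fx0 => <-.
Qed.

End Surface.

Theorem theorem6p9 (k : closedFieldType) (n m : nat)
  (s : 'I_m -> {mpoly k[n]}) :
  [pchar k] =i pred0 ->
  smooth_affine_surface s ->
  UFD_OX s ->
  (Och_trivial s <-> exists T : point k n -> Prop,
                        chain_component s T /\ denseX s T).
Proof.
move=> _ [_ [dim2 _]] ufd; split=> [Och_k|[T [compT denseT]]].
  have [g line_g] := Och_trivial_line dim2 Och_k.
  exists (chain_class s (fun j => (g j).[0])); split.
    by apply: chain_class_component; case: line_g => /(_ 0).
  exact: Och_trivial_dense_class.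
exact: dense_component_Och_trivial ufd.1 compT denseT.
Qed.
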